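(* Let $G$ be a finite commutative group with $|G|=q$, and let $A,A'\subset G$ be standard complements, i.e. standard sets with $A\cup A'=G$ and $A\cap A'=\{0\}$. Then \[ \delta(A)\,\overline\delta(A')=\lambda(A)\,\lambda(A')=\lambda^-(A)\,\lambda^+(A')=\lambda^\pm(A)\,\lambda^\pm(A')=\frac1q. \]
   Context: $G$ is written additively. A set $A\subset G$ is a standard set if $A=-A$ and $0\in A$. A character of $G$ is a homomorphism $\gamma:G\to\{z\in\mathbb C:|z|=1\}$; $\hat G$ is the group of characters and $\mathbf 1$ the principal character. For $f:G\to\mathbb R$, $\hat f(\gamma)=\sum_{x\in G}\gamma(x)f(x)$. For a standard set $A$: $\Delta(A)=\max\{|B|:B\subset G,\ (B-B)\cap A=\{0\}\}$, $\overline\Delta(A)=\max\{|B|:B\subset G,\ B-B\subset A\}$, $\delta(A)=\Delta(A)/q$, $\overline\delta(A)=1/\overline\Delta(A)$. Classes of functions $f:G\to\mathbb R$ not identically zero: $\mathcal S(A)$: $f=0$ on $G\setminus A$; $\mathcal S^-(A)$: $f\le0$ on $G\setminus A$; $\mathcal S^+(A)$: $f=0$ on $G\setminus A$, $f\ge0$ on $A$; $\mathcal S^\pm(A)$: $f\le0$ on $G\setminus A$, $f\ge0$ on $A$. $\lambda(A)=\min\{f(0)/\hat f(\mathbf 1): f\in\mathcal S(A),\ \hat f\ge0\text{ on }\hat G\}$, and $\lambda^-,\lambda^+,\lambda^\pm$ are defined likewise with $\mathcal S^-,\mathcal S^+,\mathcal S^\pm$. *)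

(* Defs.v *)
From HB Require Import structures.
From mathcomp Require Import all_boot all_order all_algebra.
From mathcomp Require Import complex.
From mathcomp Require Import all_classical all_reals.

Set Implicit Arguments.
Unset Strict Implicit.
Unset Printing Implicit Defensive.
Import Order.TTheory GRing.Theory Num.Theory.
Local Open Scope ring_scope.
Local Open Scope complex_scope.

Section SetNotions.
Variables (R : realType) (G : finZmodType).
Implicit Types A B : {set G}.

Definition diffset B : {set G} := [set x - y | x in B, y in B]%SET.

Definition standard_set A : Prop := A = [set - x | x in A]%SET /\ 0 \in A.

Definition standard_complements A A' : Prop :=
  [/\ standard_set A, standard_set A',
      A :|: A' = [set: G]%SET & A :&: A' = [set 0]%SET].

Definition Delta A : nat :=
  \max_(B : {set G} | diffset B :&: A == [set 0]%SET) #|B|.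

Definition Deltabar A : nat :=
  \max_(B : {set G} | diffset B \subset A) #|B|.

Definition delta A : R := (Delta A)%:R / #|G|%:R.

Definition deltabar A : R := 1 / (Deltabar A)%:R.

End SetNotions.

Section Fourier.
Variables (R : realType) (G : finZmodType).

Record character := Character {
  char_fun :> G -> R[i];
  char_add : forall x y, char_fun (x + y) = char_fun x * char_fun y;
  char_norm : forall x, `|char_fun x| = 1 }.

Lemma principal_add (x y : G) : (1 : R[i]) = 1 * 1.
Proof. by rewrite mulr1. Qed.

Lemma principal_norm (x : G) : `|1 : R[i]| = 1.
Proof. exact: normr1. Qed.

Definition principal : character :=
  @Character (fun=> 1) principal_add principal_norm.

Definition fourier (f : G -> R) (g : character) : R[i] :=
  \sum_(x : G) g x * (f x)%:C.

End Fourier.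

Section Lambda.
Variables (R : realType) (G : finZmodType).
Implicit Types (A : {set G}) (f : G -> R).

Definition nonzero_fun f : Prop := exists x, f x != 0.

Definition class_S A : set (G -> R) := fun f =>
  nonzero_fun f /\ (forall x, x \notin A -> f x = 0).

Definition class_Sminus A : set (G -> R) := fun f =>
  nonzero_fun f /\ (forall x, x \notin A -> f x <= 0).

Definition class_Splus A : set (G -> R) := fun f =>
  [/\ nonzero_fun f, (forall x, x \notin A -> f x = 0)
    & (forall x, x \in A -> 0 <= f x)].

Definition class_Spm A : set (G -> R) := fun f =>
  [/\ nonzero_fun f, (forall x, x \notin A -> f x <= 0)
    & (forall x, x \in A -> 0 <= f x)].

(* In R[i], 0 <= z says that z is real and nonnegative. The quotient
   f(0) / fhat(1) is formed only when fhat(1) is nonzero: f != 0 and fhat >= 0 force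
   f(0) > 0, so a function with fhat(1) = 0 has quotient +oo and is irrelevant
   to the minimum, whereas x / 0 is 0 here. *)
Definition ratios (S : set (G -> R)) : set R := fun r =>
  exists f, [/\ S f, (forall g : character R G, 0 <= fourier f g),
    fourier f (principal R G) != 0 &
    r%:C = (f 0)%:C / fourier f (principal R G)].

Definition is_minimum (E : set R) (m : R) : Prop :=
  E m /\ (forall x, E x -> m <= x).

(* An attained minimum, not an infimum; the junk value is 0 when E has no
   least element, so an equation forcing minimum E != 0 also asserts that the
   minimum is attained. *)
Definition minimum (E : set R) : R := xget 0 (is_minimum E).

Definition lambda A : R := minimum (ratios (class_S A)).
Definition lambda_minus A : R := minimum (ratios (class_Sminus A)).
Definition lambda_plus A : R := minimum (ratios (class_Splus A)).
Definition lambda_pm A : R := minimum (ratios (class_Spm A)).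

End Lambda.

Arguments delta R {G} A.
Arguments deltabar R {G} A.
Arguments lambda R {G} A.
Arguments lambda_minus R {G} A.
Arguments lambda_plus R {G} A.
Arguments lambda_pm R {G} A.

(* Main.v *)
From HB Require Import structures.
From mathcomp Require Import all_boot all_order all_algebra.
From mathcomp Require Import all_fingroup all_solvable all_field all_character.
From mathcomp Require Import complex ring lra.
From mathcomp Require Import all_classical all_reals.
Require Import Defs.

Set Implicit Arguments.
Unset Strict Implicit.
Unset Printing Implicit Defensive.
Import Order.TTheory GRing.Theory Num.Theory.
Local Open Scope ring_scope.

(** Weak duality: if [f] and [g] have nonnegative Fourier transforms and
  satisfy complementary sign conditions away from [0], then [f x * g x <= 0]
  for [x != 0], so Parseval gives
  [fhat 1 * ghat 1 <= #|G| * \sum_x f x * g x <= #|G| * (f 0 * g 0)].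
  Equality is attained by linear programming duality: the constraints on a pair
  [(f, g)] together with [f 0 <= 1], [#|G| <= ghat 1] and [g 0 <= fhat 1] form
  a finite linear system, and a Farkas certificate that it is infeasible would
  yield another pair of functions of the same two classes violating weak
  duality. The pairs of classes [(S, S)], [(S-, S+)] and [(S+-, S+-)] are
  instances: conditions [f <= 0] on [U] and [f >= 0] on [L] are complementary
  to [g <= 0] off [0 |: U] and [g >= 0] off [0 |: L]. *)

(** * The Farkas alternative for finite linear systems *)

Section Farkas.
Variable R : realFieldType.

(** The largest [u i] works, or the smallest [v j] when [P] is empty. During elimination [t] becomes
    the value of the eliminated variable. *)
Lemma finite_separation (I : finType) (P Q : pred I) (u v : I -> R) :
  (forall i j, P i -> Q j -> u i <= v j) ->
  exists t, (forall i, P i -> u i <= t) /\ (forall j, Q j -> t <= v j).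
Proof.
move=> uv; case: (pickP P) => [i0 Pi0|P0].
  case: (Order.TotalTheory.arg_maxP u Pi0) => i Pi imax.
  by exists (u i); split=> // j; apply: uv.
case: (pickP Q) => [j0 Qj0|Q0]; last first.
  by exists 0; split=> i; rewrite ?P0 ?Q0.
case: (Order.TotalTheory.arg_minP v Qj0) => j Qj jmin.
by exists (v j); split=> // i; rewrite P0.
Qed.

(* Row multipliers that cancel the column [a]; the pairs of signs that cannot be
   combined give the zero row. *)
Definition eliminator (I : finType) (a : I -> R) (k : I + I * I) (i : I) : R :=
  match k with
  | inl i1 => if a i1 == 0 then (i == i1)%:R else 0
  | inr (i1, i2) => if (0 < a i1) && (a i2 < 0)
      then (i == i2)%:R * a i1 - (i == i1)%:R * a i2 else 0
  end.

Lemma eliminator_ge0 (I : finType) (a : I -> R) k i : 0 <= eliminator a k i.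
Proof.
case: k => [i1|[i1 i2]] /=; first by case: ifP => // _; apply: ler0n.
case: ifP => // /andP[a1 a2].
by rewrite subr_ge0 (@le_trans _ _ 0) ?mulr_ge0 ?mulr_ge0_le0 ?ler0n // ltW.
Qed.

Lemma sum_delta (I : finType) (i1 : I) (x : R) (g : I -> R) :
  \sum_i (i == i1)%:R * x * g i = x * g i1.
Proof.
rewrite (bigD1 i1) //= eqxx mul1r big1 ?addr0 // => i /negPf->.
by rewrite !mul0r.
Qed.

Lemma sum_eliminator (I : finType) (a : I -> R) k (g : I -> R) :
  \sum_i eliminator a k i * g i =
  match k with
  | inl i1 => if a i1 == 0 then g i1 else 0
  | inr (i1, i2) => if (0 < a i1) && (a i2 < 0)
      then a i1 * g i2 - a i2 * g i1 else 0
  end.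
Proof.
case: k => [i1|[i1 i2]] /=; case: ifP => _; last 1 first.
- by rewrite big1 // => i _; rewrite mul0r.
- under eq_bigr do rewrite -[_%:R]mulr1.
  by rewrite sum_delta mul1r.
- by rewrite big1 // => i _; rewrite mul0r.
under eq_bigr do rewrite mulrBl.
by rewrite sumrB !sum_delta.
Qed.

(* Fourier-Motzkin elimination of the variables of [s], one at a time. *)
Lemma farkas_seq (J : eqType) (s : seq J) : uniq s ->
  forall (I : finType) (F : I -> J -> R) (b : I -> R),
  (exists x : J -> R, forall i, b i <= \sum_(j <- s) F i j * x j) \/
  (exists y : I -> R, [/\ forall i, 0 <= y i,
     {in s, forall j, \sum_i y i * F i j = 0} & 0 < \sum_i y i * b i]).
Proof.
elim: s => [_ I F b|j0 s IH /= /andP[j0s us] I F b].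
  (* With no variables left the system reads [b i <= 0], and a violated row is its own
     certificate. *)
  case: (pickP (fun i => 0 < b i)) => [i0 bi0|b0]; last first.
    by left; exists (fun=> 0) => i; rewrite big_nil leNgt b0.
  right; exists (fun i => (i == i0)%:R); split=> //.
    by under eq_bigr do rewrite -[_%:R]mulr1; rewrite sum_delta mul1r.
pose m := eliminator (F ^~ j0).
have [[x xP]|[y [y0 yF yb]]] :=
  IH us _ (fun k j => \sum_i m k i * F i j) (fun k => \sum_i m k i * b i).
- left; pose e i := b i - \sum_(j <- s) F i j * x j.
  have eP k : \sum_i m k i * e i <= 0.
    have -> : \sum_i m k i * e i = \sum_i m k i * b i -
        \sum_(j <- s) (\sum_i m k i * F i j) * x j.
      rewrite (eq_bigr (fun j => \sum_i m k i * (F i j * x j))) => [|j _].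
        rewrite exchange_big -sumrB; apply: eq_bigr => i _.
        by rewrite -mulr_sumr -mulrBr.
      by rewrite mulr_suml; apply: eq_bigr => i _; rewrite mulrA.
    by rewrite subr_le0.
  (* The value [t] must satisfy [e i <= F i j0 * t]: positive coefficients bound it from below,
     negative ones from above, and the eliminated row [(i, j)] makes the two bounds compatible. *)
  have [i j Fi Fj|t [t1 t2]] := @finite_separation I (fun i => 0 < F i j0)
     (fun i => F i j0 < 0) (fun i => e i / F i j0) (fun i => e i / F i j0).
    have := eP (inr (i, j)); rewrite /m sum_eliminator Fi Fj /= => h.
    by rewrite ler_pdivrMr // mulrAC ler_ndivlMr // mulrC; lra.
  exists (fun j => if j == j0 then t else x j) => i.
  rewrite big_cons eqxx.
  have -> : \sum_(j <- s) F i j * (if j == j0 then t else x j)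
          = \sum_(j <- s) F i j * x j.
    rewrite !big_seq; apply: eq_bigr => j js; case: eqP => // jj.
    by rewrite -jj js in j0s.
  rewrite -lerBlDr -/(e i); case: (ltrgtP (F i j0) 0) => Fi.
  + by move: (t2 _ Fi); rewrite ler_ndivlMr // mulrC.
  + by move: (t1 _ Fi); rewrite ler_pdivrMr // mulrC.
  by have := eP (inl i); rewrite /m sum_eliminator Fi eqxx mul0r.
(* Eliminated rows are nonnegative combinations of the original rows, so the certificate pulls back
   through [m]. *)
right; exists (fun i => \sum_k y k * m k i).
have swap (g : I -> R) : \sum_i (\sum_k y k * m k i) * g i
                       = \sum_k y k * (\sum_i m k i * g i).
  under eq_bigr do rewrite mulr_suml; rewrite exchange_big /=.
  apply: eq_bigr => k _; rewrite mulr_sumr.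
  by apply: eq_bigr => i _; rewrite mulrA.
split.
- by move=> i; apply: sumr_ge0 => k _; rewrite mulr_ge0 // eliminator_ge0.
- move=> j; rewrite inE swap => /orP[/eqP->|/yF //].
  apply: big1 => -[i1|[i1 i2]] _; rewrite /m sum_eliminator.
    by case: eqP => [->|]; rewrite mulr0.
  by case: ifP; rewrite ?mulr0 // [X in _ * (X - _)]mulrC subrr mulr0.
- by rewrite swap.
Qed.

Lemma farkas (I J : finType) (F : I -> J -> R) (b : I -> R) :
  (exists x : J -> R, forall i, b i <= \sum_j F i j * x j) \/
  (exists y : I -> R, [/\ forall i, 0 <= y i,
     forall j, \sum_i y i * F i j = 0 & 0 < \sum_i y i * b i]).
Proof.
have [?|[y [y0 yF yb]]] := farkas_seq (index_enum_uniq J) F b; first by left.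
by right; exists y; split=> // j; apply: yF; rewrite mem_index_enum.
Qed.

End Farkas.

(** * Roots of unity and homomorphisms to a cyclic group *)

Lemma prim_root_exists (F : closedFieldType) n : n%:R != 0 :> F ->
  exists z : F, n.-primitive_root z.
Proof.
move=> n_neq0; have n_gt0 : (0 < n)%N.
  by rewrite lt0n; apply: contraNneq n_neq0 => ->.
pose p : {poly F} := 'X^n - 1; have [r Dp] := closed_field_poly_normal p.
rewrite (monicP _) ?monicXnsubC // scale1r in Dp.
have rn1 : all n.-unity_root r by apply/allP=> z; rewrite -root_prod_XsubC -Dp.
have sz_r : (n < (size r).+1)%N.
  by rewrite -(size_prod_XsubC r id) -Dp size_XnsubC.
(* [X^n - 1] is separable because [n] is nonzero in [F], so its [n] roots are distinct and one of
   them is primitive. *)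
have [|z] := hasP (has_prim_root n_gt0 rn1 _ sz_r); last by exists z.
by rewrite -separable_prod_XsubC -Dp separable_Xn_sub_1.
Qed.

Section Homs.
Variable G : finZmodType.

(* The codomain is the cyclic group of order #|G|; its additive structure is
   only available for successors. *)
Notation Zq := 'I_(#|G|.-1).+1.

(** Characters are encoded by their exponents, so that the dual group can be summed over and carried
    from one field to another. *)
Definition is_hom (k : {ffun G -> Zq}) :=
  [forall x, forall y, k (x + y) == k x + k y].

Lemma is_homP (k : {ffun G -> Zq}) :
  reflect (forall x y, k (x + y) = k x + k y) (is_hom k).
Proof.
apply: (iffP forallP) => [h x y|h x]; first by have /forallP/(_ y)/eqP := h x.
by apply/forallP => y; rewrite h.
Qed.

Lemma prednKG : #|G|.-1.+1 = #|G|.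
Proof. by rewrite prednK //; apply/card_gt0P; exists 0. Qed.

Lemma mulrn_card (x : G) : x *+ #|G| = 0.
Proof. by have := @expg_cardG G [set: G]%G x (finset.in_setT x); rewrite cardsT. Qed.

Section ToField.
Variables (F : fieldType) (z : F).
Hypothesis prim_z : (#|G|.-1.+1).-primitive_root z.

Lemma expr_Zq_add (a b : Zq) : z ^+ (a + b)%R = z ^+ a * z ^+ b.
Proof. by rewrite /= (prim_expr_mod prim_z) exprD. Qed.

Lemma expr_Zq_inj : injective (fun a : Zq => z ^+ a).
Proof.
move=> a b /eqP; rewrite (eq_prim_root_expr prim_z) !modn_small ?ltn_ord //.
by move/eqP/val_inj.
Qed.

(** [#|G|] annihilates [G], so the values of [g] are powers of [z]; their exponents add because
    distinct elements of [Zq] give distinct powers. *)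
Lemma multiplicative_hom (g : G -> F) :
  g 0 = 1 -> (forall x y, g (x + y) = g x * g y) ->
  exists2 k, is_hom k & forall x, g x = z ^+ k x.
Proof.
move=> g0 gD; have gX x n : g (x *+ n) = g x ^+ n.
  by elim: n => [|n IH]; rewrite ?mulr0n ?g0 // mulrS exprS gD IH.
have g1 x : g x ^+ #|G|.-1.+1 = 1 by rewrite prednKG -gX mulrn_card.
pose k := [ffun x => sval (prim_rootP prim_z (g1 x))].
have kE x : g x = z ^+ k x by rewrite ffunE; case: prim_rootP.
exists k => //; apply/is_homP => x y; apply: expr_Zq_inj.
by rewrite expr_Zq_add -!kE gD.
Qed.

End ToField.

(* The irreducible complex characters of an abelian group are linear and have
   no common kernel. *)
Lemma hom_separation (x : G) : x != 0 -> exists2 k, is_hom k & k x != 0.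
Proof.
move=> x0; have [z prim_z] : exists z : algC, (#|G|.-1.+1).-primitive_root z.
  by apply: prim_root_exists; rewrite pnatr_eq0.
have lin := char_abelianP [set: G]%G (FinRing.zmod_abelian _).
have [i xi] : exists i : Iirr [set: G]%G, x \notin cfker 'chi_i.
  apply/existsP; rewrite -negb_forall; apply: contra x0 => /forallP xker.
  have : x \in \bigcap_i cfker 'chi[[set: G]%G]_i by apply/bigcapP.
  by rewrite TI_cfker_irr inE.
(* The exponent map of this character does not mention [algC], so it can be reused over [R[i]]. *)
have [] := @multiplicative_hom _ z prim_z 'chi_i.
- exact: lin_char1 (lin i).
- by move=> u v; rewrite -(lin_charM (lin i)) ?inE.
move=> k homk kE; exists k => //; apply: contra xi => /eqP kx.
by rewrite cfkerEirr inE kE kx expr0 eq_sym; apply/eqP/lin_char1/lin.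
Qed.

End Homs.

(** * Orthogonality of characters and of their real parts *)

Section RealCharacters.
Variables (R : realType) (G : finZmodType).
Local Open Scope complex_scope.
Notation q := #|G|.
Notation Zq := 'I_(#|G|.-1).+1.

Lemma Re_sum (I : Type) (s : seq I) (P : pred I) (f : I -> R[i]) :
  complex.Re (\sum_(i <- s | P i) f i) = \sum_(i <- s | P i) complex.Re (f i).
Proof. by apply: (big_morph _ (id1 := 0) (op1 := +%R)) => // -[a b] [c d]. Qed.

Lemma Im_sum (I : Type) (s : seq I) (P : pred I) (f : I -> R[i]) :
  complex.Im (\sum_(i <- s | P i) f i) = \sum_(i <- s | P i) complex.Im (f i).
Proof. by apply: (big_morph _ (id1 := 0) (op1 := +%R)) => // -[a b] [c d]. Qed.

Lemma normc1_conj (u : R[i]) : `|u| = 1 -> u^-1 = conjc u.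
Proof. by move=> u1; rewrite invc_norm u1 expr1n invr1 mul1r. Qed.

Lemma char0 (g : character R G) : g 0 = 1.
Proof.
have g0 : g 0 != 0 by rewrite -normr_eq0 char_norm oner_eq0.
by apply: (mulfI g0); rewrite -char_add addr0 mulr1.
Qed.

Lemma charN (g : character R G) x : g (- x) = conjc (g x).
Proof.
have gx : g x != 0 by rewrite -normr_eq0 char_norm oner_eq0.
rewrite -normc1_conj ?char_norm //; apply: (mulfI gx).
by rewrite mulfV // -char_add subrr char0.
Qed.

Lemma Re_conjc (u : R[i]) : complex.Re (conjc u) = complex.Re u.
Proof. by case: u. Qed.

(** The product-to-sum formula reduces products of real parts to character sums. *)
Lemma Re_prod (u v : R[i]) :
  complex.Re u * complex.Re v *+ 2 = complex.Re (u * v) + complex.Re (u * conjc v).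
Proof. by case: u => a b; case: v => c d /=; ring. Qed.

Section Family.
Variable w : R[i].
Hypothesis prim_w : (#|G|.-1.+1).-primitive_root w.

Definition chi (k : {ffun G -> Zq}) (x : G) : R[i] := w ^+ k x.

Lemma chiD k l x : chi (k + l) x = chi k x * chi l x.
Proof. by rewrite /chi ffunE (expr_Zq_add prim_w). Qed.

Lemma chi0 x : chi 0 x = 1.
Proof. by rewrite /chi ffunE expr0. Qed.

Lemma chi_norm k x : `|chi k x| = 1.
Proof.
apply/eqP; rewrite -(@pexpr_eq1 _ _ #|G|.-1.+1) // -normrX -exprM mulnC exprM.
by rewrite (prim_expr_order prim_w) expr1n normr1.
Qed.

Lemma chiN k x : chi (- k) x = conjc (chi k x).
Proof.
have kx : chi k x != 0 by rewrite -normr_eq0 chi_norm oner_eq0.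
rewrite -normc1_conj ?chi_norm //; apply: (mulfI kx).
by rewrite mulfV // -chiD subrr chi0.
Qed.

Lemma is_hom0 : is_hom (0 : {ffun G -> Zq}).
Proof. by apply/is_homP => x y; rewrite !ffunE addr0. Qed.

Lemma is_homD (k l : {ffun G -> Zq}) : is_hom k -> is_hom l -> is_hom (k + l).
Proof.
by move=> /is_homP hk /is_homP hl; apply/is_homP => x y; rewrite !ffunE hk hl addrACA.
Qed.

Lemma is_homN (k : {ffun G -> Zq}) : is_hom k -> is_hom (- k).
Proof. by move=> /is_homP hk; apply/is_homP => x y; rewrite !ffunE hk opprD. Qed.

Lemma chi_add k x y : is_hom k -> chi k (x + y) = chi k x * chi k y.
Proof. by move=> /is_homP hk; rewrite /chi hk (expr_Zq_add prim_w). Qed.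

Lemma chi_char k : is_hom k -> exists g : character R G, g =1 chi k.
Proof.
by move=> hk; exists (Character (fun x y => chi_add x y hk) (chi_norm k)).
Qed.

Lemma char_chi (g : character R G) : exists2 k, is_hom k & g =1 chi k.
Proof. exact: (multiplicative_hom prim_w (char0 g) (char_add g)). Qed.

(** Translation by [y] multiplies the sum by [chi k y], which differs from 1 for some [y] when [k]
    is nonzero. *)
Lemma sum_chi_group k : is_hom k ->
  \sum_x chi k x = if k == 0 then q%:R else 0.
Proof.
move=> hk; case: eqP => [->|k0].
  by under eq_bigr do rewrite chi0; rewrite sumr_const.
have [y ky] : exists y, chi k y != 1.
  apply/existsP; rewrite -negb_forall; apply/negP => /forallP h; apply: k0.
  apply/ffunP => y; apply: (expr_Zq_inj prim_w).
  by rewrite ffunE expr0; apply/eqP/h.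
apply/eqP; set S := \sum_x _.
have : (chi k y - 1) * S == 0.
  rewrite mulrBl mul1r subr_eq0 {2}/S (reindex_inj (addrI y)) /= mulr_sumr.
  by apply/eqP/eq_bigr => x _; rewrite chi_add.
by rewrite mulf_eq0 subr_eq0 (negPf ky).
Qed.

Lemma sum_chi_dual_neq0 x : x != 0 -> \sum_(k | is_hom k) chi k x = 0.
Proof.
move=> x0; have [l hl lx] := hom_separation x0.
have lx1 : chi l x != 1.
  apply: contra lx => /eqP lx; apply/eqP/(expr_Zq_inj prim_w).
  by rewrite expr0.
apply/eqP; set S := \sum_(k | _) _.
have : (chi l x - 1) * S == 0.
  rewrite mulrBl mul1r subr_eq0 {2}/S (reindex_inj (addrI l)) /= mulr_sumr.
  apply/eqP/eq_big => k; last by rewrite chiD.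
  apply/idP/idP => [|h]; first exact: is_homD.
  by rewrite -(addKr l k) is_homD // is_homN.
by rewrite mulf_eq0 subr_eq0 (negPf lx1).
Qed.

(** The order of the dual group is found by double counting: in the sum over [x] and [k], only
    [x = 0] contributes in one order and only [k = 0] in the other. *)
Lemma sum_chi_dual0 : \sum_(k | is_hom k) chi k 0 = q%:R.
Proof.
transitivity (\sum_x \sum_(k | is_hom k) chi k x).
  rewrite [RHS](bigD1 0) //= [X in _ + X]big1 ?addr0 // => x.
  exact: sum_chi_dual_neq0.
rewrite exchange_big /= (bigD1 (0 : {ffun G -> Zq})) ?is_hom0 //= sum_chi_group ?is_hom0 // eqxx.
rewrite big1 ?addr0 // => k /andP[hk /negPf k0].
by rewrite sum_chi_group // k0.
Qed.

Lemma sum_chi_dual x :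
  \sum_(k | is_hom k) complex.Re (chi k x) = (x == 0)%:R * q%:R.
Proof.
rewrite -Re_sum; case: eqP => [->|/eqP/sum_chi_dual_neq0->]; last by rewrite mul0r.
by rewrite sum_chi_dual0 mul1r -(rmorph_nat (real_complex R)).
Qed.

End Family.

(** A finite list of the real parts of all characters turns positivity of the transform into a
    finite real linear system. Real parts are even, whence the term [x == - y]. The last clause
    gives nonnegative combinations of the rows nonnegative transforms. *)
Definition is_dual_family (T : finType) (c : T -> G -> R) :=
  [/\ forall t, exists g : character R G, forall x, c t x = complex.Re (g x),
      forall g : character R G, exists t, forall x, c t x = complex.Re (g x),
      forall x y, \sum_t c t x * c t y =
                  ((x == y)%:R + (x == - y)%:R) * q%:R / 2
    & forall s t, 0 <= \sum_x c s x * c t x].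

Lemma dual_family_exists : exists (T : finType) (c : T -> G -> R),
  is_dual_family c.
Proof.
have [w prim_w] : exists w : R[i], (#|G|.-1.+1).-primitive_root w.
  by apply: prim_root_exists; rewrite pnatr_eq0.
pose T := {k : {ffun G -> Zq} | is_hom k}.
pose t0 : T := Sub 0 is_hom0.
have sumT (f : {ffun G -> Zq} -> R) :
    \sum_(t : T) f (val t) = \sum_(k | is_hom k) f k.
  rewrite [RHS](reindex_onto val (insubd t0)) => [|k]; last exact: insubdK.
  by apply: eq_bigl => t; rewrite valKd eqxx (valP t).
exists T, (fun t x => complex.Re (chi w (val t) x)); split.
- move=> t; have [g gE] := chi_char prim_w (valP t).
  by exists g => x; rewrite gE.
- move=> g; have [k hk gE] := char_chi prim_w g.
  by exists (Sub k hk) => x; rewrite SubK gE.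
- move=> x y; rewrite (sumT (fun k => complex.Re (chi w k x) * complex.Re (chi w k y))).
  apply: (@mulIf _ 2); rewrite ?pnatr_eq0 // mulfVK ?pnatr_eq0 // mulr_natr.
  rewrite -sumrMnl mulrDl -subr_eq0 -[x == - y]subr_eq0 opprK -!(sum_chi_dual prim_w).
  rewrite addrC -big_split /=; apply: eq_bigr => k hk.
  have [g gE] := chi_char prim_w hk.
  by rewrite Re_prod -!gE -charN -!char_add.
- move=> s t; rewrite -(pmulrn_lge0 _ (n := 2)) // -sumrMnl.
  under eq_bigr do rewrite Re_prod -chiN // -!chiD //.
  rewrite big_split /= -!Re_sum !sum_chi_group //; last 2 first.
  + by rewrite is_homD ?is_homN ?(valP s) ?(valP t).
  + by rewrite is_homD ?(valP s) ?(valP t).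
  have q0 : 0 <= complex.Re (q%:R : R[i]).
    by rewrite -(rmorph_nat (real_complex R)) ler0n.
  by rewrite addr_ge0 //; case: eqP.
Qed.

End RealCharacters.

(** * Weak and strong duality for sign classes *)

Section Duality.
Variables (R : realType) (G : finZmodType) (T : finType) (c : T -> G -> R).
Hypothesis dualc : is_dual_family c.
Notation q := (#|G|%:R : R).

Definition sign_class (U L : {set G}) (f : G -> R) :=
  (forall x, x \in U -> f x <= 0) /\ (forall x, x \in L -> 0 <= f x).

Definition cos_transform (f : G -> R) (t : T) := \sum_x c t x * f x.

(** This constrains only the real part of the Fourier transform; [symmetrize] later makes the
    transform real. *)
Definition positive_type (f : G -> R) := forall t, 0 <= cos_transform f t.

Definition punctured_compl (U : {set G}) : {set G} := (~: (0 |: U))%SET.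

Lemma in_punctured_compl (U : {set G}) x :
  (x \in punctured_compl U) = (x != 0) && (x \notin U).
Proof. by rewrite !inE negb_or. Qed.

Lemma punctured_complK (U : {set G}) : 0 \notin U ->
  punctured_compl (punctured_compl U) = U.
Proof.
move=> U0; apply/setP => x; rewrite !in_punctured_compl negb_and !negbK.
by case: eqP => //= ->; rewrite (negPf U0).
Qed.

Lemma dual_family0 t : c t 0 = 1.
Proof. by have [/(_ t)[g ->] _ _ _] := dualc; rewrite char0. Qed.

Lemma dual_family_principal : exists t, forall x, c t x = 1.
Proof. by have [_ /(_ (principal R G))[t tE] _ _] := dualc; exists t. Qed.

Lemma parseval (f g : G -> R) :
  \sum_t cos_transform f t * cos_transform g t =
  q / 2 * \sum_x f x * (g x + g (- x)).
Proof.
transitivity (\sum_x \sum_y f x * g y * \sum_t c t x * c t y).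
  rewrite (eq_bigr (fun t => \sum_x \sum_y f x * g y * (c t x * c t y))).
    rewrite exchange_big; apply: eq_bigr => x _; rewrite exchange_big /=.
    by apply: eq_bigr => y _; rewrite mulr_sumr.
  move=> t _; rewrite mulr_suml; apply: eq_bigr => x _; rewrite mulr_sumr.
  by apply: eq_bigr => y _; ring.
rewrite mulr_sumr; apply: eq_bigr => x _.
have [_ _ orth _] := dualc.
transitivity (f x * (q / 2) * (\sum_y (y == x)%:R * 1 * g y +
                               \sum_y (y == - x)%:R * 1 * g y)).
  rewrite -big_split mulr_sumr; apply: eq_bigr => y _ /=.
  by rewrite orth (eq_sym x) -eqr_oppLR (eq_sym (- x)); field.
by rewrite !sum_delta; ring.
Qed.

(** Parseval against the indicator of 0 writes [q * f 0] as the sum of all transform values, one of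
    which is [\sum_x f x]. *)
Lemma sum_le_at0 (f : G -> R) : positive_type f -> \sum_x f x <= q * f 0.
Proof.
move=> pf; have [t1 t1E] := dual_family_principal.
have -> : \sum_x f x = cos_transform f t1.
  by apply: eq_bigr => x _; rewrite t1E mul1r.
have -> : q * f 0 = \sum_t cos_transform f t.
  have := parseval f (fun x => (x == 0)%:R * 1).
  rewrite (eq_bigr (cos_transform f)) => [->|t _]; last first.
    rewrite [X in _ * X](_ : _ = 1) ?mulr1 // /cos_transform.
    by under eq_bigr do rewrite mulrC; rewrite sum_delta mul1r dual_family0.
  rewrite (eq_bigr (fun x => (x == 0)%:R * 2 * f x)) => [|x _]; last first.
    by rewrite oppr_eq0; ring.
  by rewrite sum_delta; field.
by rewrite [leRHS](bigD1 t1) //= lerDl sumr_ge0.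
Qed.

Lemma weak_duality (U L : {set G}) (f g : G -> R) :
  (forall x, (- x \in U) = (x \in U)) -> (forall x, (- x \in L) = (x \in L)) ->
  sign_class U L f ->
  sign_class (punctured_compl U) (punctured_compl L) g ->
  positive_type f -> positive_type g ->
  (\sum_x f x) * (\sum_x g x) <= q * (f 0 * g 0).
Proof.
move=> symU symL [fU fL] [gU gL] pf pg; have [t1 t1E] := dual_family_principal.
have sumE h : \sum_x h x = cos_transform h t1.
  by apply: eq_bigr => x _; rewrite t1E mul1r.
apply: (@le_trans _ _ (\sum_t cos_transform f t * cos_transform g t)).
  by rewrite [leRHS](bigD1 t1) //= !sumE lerDl sumr_ge0 // => t _; rewrite mulr_ge0.
rewrite parseval (bigD1 0) //= oppr0.
(* [parseval] pairs [x] with both [x] and [- x]. Membership in both sets forces [f x = 0], in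
   neither [g y = 0], and in exactly one opposite signs. *)
have neg x y : x != 0 -> y != 0 -> (y \in U) = (x \in U) ->
    (y \in L) = (x \in L) -> f x * g y <= 0.
  move=> x0 y0 yU yL.
  have := gU y; have := gL y; rewrite !in_punctured_compl y0 /= yU yL.
  have := fU x; have := fL x.
  case: (x \in U); case: (x \in L) => /= f1 f2 g1 g2.
  - have -> : f x = 0 by apply/eqP; rewrite eq_le f1 ?f2.
    by rewrite mul0r.
  - by rewrite mulr_le0_ge0 ?f2 ?g1.
  - by rewrite mulr_ge0_le0 ?f1 ?g2.
  - have -> : g y = 0 by apply/eqP; rewrite eq_le g1 ?g2.
    by rewrite mulr0.
have : \sum_(x | x != 0) f x * (g x + g (- x)) <= 0.
  apply: sumr_le0 => x x0; rewrite mulrDr -(addr0 0) lerD ?neg ?oppr_eq0 //.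
have : 0 <= q by rewrite ler0n.
by move: (\sum_(x | _) _) => S q0 S0; nra.
Qed.

(** A point without a sign constraint gets a zero row, so the index type does not depend on [U] and
    [L]. *)
Definition cone_row (U L : {set G}) (j : T + (G + G)) (x : G) : R :=
  match j with
  | inl t => c t x
  | inr (inl y) => (y == x)%:R * - (y \in U)%:R
  | inr (inr y) => (y == x)%:R * (y \in L)%:R
  end.

Lemma cone_rowP (U L : {set G}) (f : G -> R) :
  (forall j, 0 <= \sum_x cone_row U L j x * f x) ->
  sign_class U L f /\ positive_type f.
Proof.
move=> h; split; last by move=> t; apply: (h (inl t)).
split=> x xU.
  have := h (inr (inl x)); rewrite /= (eq_bigr (fun y => (y == x)%:R * -1 * f y)).
    by rewrite sum_delta mulN1r oppr_ge0.
  by move=> y _; rewrite xU eq_sym.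
have := h (inr (inr x)); rewrite /= (eq_bigr (fun y => (y == x)%:R * 1 * f y)).
  by rewrite sum_delta mul1r.
by move=> y _; rewrite xU eq_sym.
Qed.

(** The multipliers of the transform rows, with weight [u] added on the principal character, combine
    cosines into a function of positive type. The hypothesis expresses it also through the sign
    rows, supported on [U] and [L], which fixes its signs off these sets. *)
Lemma certificate_dual (U L : {set G}) (y : T + (G + G) -> R) (s u : R) :
  0 \notin U -> 0 \notin L -> (forall j, 0 <= y j) -> 0 <= u ->
  (forall x, \sum_j y j * cone_row U L j x = (x == 0)%:R * s - u) ->
  exists g, [/\ sign_class (punctured_compl U) (punctured_compl L) g,
    positive_type g, g 0 = s & u * q <= \sum_x g x].
Proof.
move=> U0 L0 y0 u0 yE; have [_ _ _ cc] := dualc.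
have [t1 t1E] := dual_family_principal.
pose g x := \sum_t y (inl t) * c t x + u.
have gE x : g x = (x == 0)%:R * s + y (inr (inl x)) * (x \in U)%:R
                  - y (inr (inr x)) * (x \in L)%:R.
  have := yE x; rewrite !big_sumType /=.
  rewrite [X in _ + (X + _)](eq_bigr
    (fun z => (z == x)%:R * 1 * (y (inr (inl z)) * - (z \in U)%:R))).
    rewrite [X in _ + (_ + X)](eq_bigr
      (fun z => (z == x)%:R * 1 * (y (inr (inr z)) * (z \in L)%:R))).
      by rewrite !sum_delta /g => h; lra.
    by move=> z _; ring.
  by move=> z _; ring.
exists g; split.
- split=> x; rewrite in_punctured_compl => /andP[/negPf x0 /negPf xU].
    by rewrite gE x0 xU mul0r mulr0 !add0r oppr_le0 mulr_ge0 ?ler0n.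
  by rewrite gE x0 xU mul0r mulr0 add0r subr0 mulr_ge0 ?ler0n.
- move=> t; rewrite /cos_transform.
  rewrite (eq_bigr (fun x => \sum_s y (inl s) * (c t x * c s x)
                             + u * (c t x * c t1 x))) => [|x _]; last first.
    rewrite /g mulrDr mulr_sumr t1E; congr (_ + _); last by ring.
    by apply: eq_bigr => r _; ring.
  rewrite big_split /= -mulr_sumr addr_ge0 ?mulr_ge0 // exchange_big /=.
  by rewrite sumr_ge0 // => r _; rewrite -mulr_sumr mulr_ge0.
- by rewrite gE eqxx (negPf U0) (negPf L0) !mulr0 mul1r addr0 subr0.
- rewrite /g big_split /= sumr_const mulr_natr lerDr exchange_big /=.
  apply: sumr_ge0 => t _; rewrite -mulr_sumr mulr_ge0 //.
  have := cc t t1; congr (_ <= _); apply: eq_bigr => x _.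
  by rewrite t1E mulr1.
Qed.

(* The constraints on [f] and [g] are solvable together, since a Farkas
   certificate of infeasibility would itself be a pair violating weak duality. *)
Lemma strong_duality (U L : {set G}) :
  (forall x, (- x \in U) = (x \in U)) -> (forall x, (- x \in L) = (x \in L)) ->
  0 \notin U -> 0 \notin L ->
  exists f g : G -> R,
    [/\ sign_class U L f /\ positive_type f,
        sign_class (punctured_compl U) (punctured_compl L) g /\ positive_type g,
        f 0 <= 1, q <= \sum_x g x & g 0 <= \sum_x f x].
Proof.
move=> symU symL U0 L0.
set U' := punctured_compl U; set L' := punctured_compl L.
have U'0 : 0 \notin U' by rewrite in_punctured_compl eqxx.
have L'0 : 0 \notin L' by rewrite in_punctured_compl eqxx.
pose J := (T + (G + G))%type.
(* The unknown is the pair [(f, g)]. After the two cones come [- f 0 >= -1], [\sum_x g x >= q] and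
   [\sum_x f x - g 0 >= 0]. *)
pose row (i : (J + J) + ('I_1 + ('I_1 + 'I_1))) (v : G + G) : R :=
  match i, v with
  | inl (inl j), inl x => cone_row U L j x
  | inl (inr j), inr x => cone_row U' L' j x
  | inr (inl _), inl x => (x == 0)%:R * -1
  | inr (inr (inl _)), inr x => 1
  | inr (inr (inr _)), inl x => 1
  | inr (inr (inr _)), inr x => (x == 0)%:R * -1
  | _, _ => 0
  end.
pose b (i : (J + J) + ('I_1 + ('I_1 + 'I_1))) : R :=
  match i with
  | inl _ => 0
  | inr (inl _) => -1
  | inr (inr (inl _)) => q
  | inr (inr (inr _)) => 0
  end.
have [[v vP]|[y [y0 yF yb]]] := farkas row b.
  have zero (h : G + G -> R) : \sum_x 0 * h (inl x) = 0.
    by rewrite big1 // => x _; rewrite mul0r.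
  have zero' (h : G + G -> R) : \sum_x 0 * h (inr x) = 0.
    by rewrite big1 // => x _; rewrite mul0r.
  exists (v \o inl), (v \o inr); split.
  - apply: cone_rowP => j; have := vP (inl (inl j)).
    by rewrite big_sumType /= zero' addr0.
  - apply: cone_rowP => j; have := vP (inl (inr j)).
    by rewrite big_sumType /= zero add0r.
  - have := vP (inr (inl 0)); rewrite big_sumType /= zero' addr0 sum_delta.
    by rewrite mulN1r lerN2.
  - have := vP (inr (inr (inl 0))); rewrite big_sumType /= zero add0r.
    by under eq_bigr do rewrite mul1r.
  - have := vP (inr (inr (inr 0))); rewrite big_sumType /= sum_delta mulN1r.
    by under eq_bigr do rewrite mul1r; rewrite subr_ge0.
exfalso.
pose s := y (inr (inl 0)); pose r := y (inr (inr (inl 0))).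
pose u := y (inr (inr (inr 0))).
have [s0 r0 u0] : [/\ 0 <= s, 0 <= r & 0 <= u] by split; apply: y0.
have lt_s : s < r * q.
  move: yb; rewrite big_sumType /= [X in X + _]big1 => [|j _]; last by rewrite mulr0.
  by rewrite !big_sumType !big_ord1 /= -/s -/r -/u; lra.
(* The columns of the first unknown produce a function in the class of the second, and vice
   versa. *)
have [|g [gUL pg g0 gs]] := @certificate_dual U L (y \o inl \o inl) s u U0 L0
    (fun j => y0 (inl (inl j))) u0.
  move=> x; have := yF (inl x); rewrite big_sumType /= [X in X + _]big_sumType /=.
  rewrite [X in _ + X]big_sumType /= [X in _ + (_ + X)]big_sumType /= !big_ord1.
  rewrite -/s -/r -/u.
  rewrite [X in _ + X + _]big1 => [h|j _]; last by rewrite mulr0.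
  by lra.
have [|f [fUL pf f0 fs]] := @certificate_dual U' L' (y \o inl \o inr) u r U'0 L'0
    (fun j => y0 (inl (inr j))) r0.
  move=> x; have := yF (inr x); rewrite big_sumType /= [X in X + _]big_sumType /=.
  rewrite [X in _ + X]big_sumType /= [X in _ + (_ + X)]big_sumType /= !big_ord1.
  rewrite -/s -/r -/u.
  rewrite [X in X + _ + _]big1 => [h|j _]; last by rewrite mulr0.
  by lra.
rewrite !punctured_complK // in fUL.
have := weak_duality symU symL fUL gUL pf pg.
have := sum_le_at0 pf; rewrite f0 g0.
have q0 : 0 < q by rewrite -prednKG ltr0Sn.
move: fs gs; move: (\sum_x f x) (\sum_x g x) => S S' fs gs Su SS.
(* As [s < r * q], this forces [u = 0]; then [r <= u] gives [r = 0], hence [s < 0], a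
   contradiction. *)
have : r * q * (u * q) <= q * (u * s).
  by apply: le_trans SS; rewrite ler_pM ?mulr_ge0 // ltW.
have : r <= u by rewrite -(ler_pM2r q0) [leRHS]mulrC; apply: le_trans Su.
nra.
Qed.

End Duality.

(** * From duality to the minima of ratios *)

Section Extremal.
Variables (R : realType) (G : finZmodType).
Local Open Scope complex_scope.
Notation q := (#|G|%:R : R).

Lemma Re_fourier (f : G -> R) (g : character R G) :
  complex.Re (fourier f g) = \sum_x complex.Re (g x) * f x.
Proof.
rewrite /fourier Re_sum; apply: eq_bigr => x _.
by case: (g x) => a b /=; rewrite mulr0 subr0.
Qed.

Lemma Im_fourier (f : G -> R) (g : character R G) :
  complex.Im (fourier f g) = \sum_x complex.Im (g x) * f x.
Proof.
rewrite /fourier Im_sum; apply: eq_bigr => x _.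
by case: (g x) => a b /=; rewrite mulr0 add0r.
Qed.

Lemma fourier_principal (f : G -> R) :
  fourier f (principal R G) = (\sum_x f x)%:C.
Proof.
by rewrite rmorph_sum; apply: eq_bigr => x _; rewrite /= mul1r.
Qed.

Lemma ratiosP (S : set (G -> R)) (r : R) : ratios S r <->
  exists f, [/\ S f, forall g, 0 <= fourier f g, \sum_x f x != 0
              & r = f 0 / \sum_x f x].
Proof.
split=> -[f [Sf pf sf rf]]; exists f; split=> //.
- by apply: contra sf; rewrite fourier_principal => /eqP->.
- by move: rf; rewrite fourier_principal -fmorph_div => /(congr1 (@complex.Re R)).
- by rewrite fourier_principal fmorph_eq0.
- by rewrite rf fourier_principal fmorph_div.
Qed.

Lemma minimum_eq (E : set R) (m : R) : is_minimum E m -> minimum E = m.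
Proof.
move=> Em; apply: xget_unique => // m' [Em' lem'].
by apply/eqP; rewrite eq_le lem' ?Em.2 //; case: Em.
Qed.

(** Passing to the even part makes the Fourier transform real and keeps the value at 0, the total
    sum and any symmetric sign class. *)
Definition symmetrize (f : G -> R) (x : G) : R := (f x + f (- x)) / 2.

Lemma symmetrize0 f : symmetrize f 0 = f 0.
Proof. by rewrite /symmetrize oppr0; field. Qed.

Lemma sum_even_symmetrize (e f : G -> R) : (forall x, e (- x) = e x) ->
  \sum_x e x * symmetrize f x = \sum_x e x * f x.
Proof.
move=> eN; have -> : \sum_x e x * symmetrize f x =
    (\sum_x e x * f x + \sum_x e x * f (- x)) / 2.
  by rewrite -big_split mulr_suml; apply: eq_bigr => x _ /=; rewrite /symmetrize; ring.
rewrite [X in _ + X](reindex_inj oppr_inj) /=.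
by under [X in _ + X]eq_bigr do rewrite opprK eN; field.
Qed.

Lemma sum_symmetrize f : \sum_x symmetrize f x = \sum_x f x.
Proof.
have /= := @sum_even_symmetrize (fun=> 1) f (fun=> erefl).
by under eq_bigr do rewrite mul1r; under [RHS]eq_bigr do rewrite mul1r.
Qed.

Lemma sum_odd_symmetrize (e f : G -> R) : (forall x, e (- x) = - e x) ->
  \sum_x e x * symmetrize f x = 0.
Proof.
move=> eN; set S := (LHS).
have : S = - S.
  rewrite {1}/S (reindex_inj oppr_inj) /= -sumrN; apply: eq_bigr => x _.
  by rewrite eN mulNr /symmetrize opprK [f (- x) + _]addrC.
by lra.
Qed.

Lemma symmetrize_sign_class (U L : {set G}) (f : G -> R) :
  (forall x, (- x \in U) = (x \in U)) -> (forall x, (- x \in L) = (x \in L)) ->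
  sign_class U L f -> sign_class U L (symmetrize f).
Proof.
move=> symU symL [fU fL]; split=> x xU.
  by have := fU x xU; have := fU (- x); rewrite symU /symmetrize => /(_ xU); lra.
by have := fL x xU; have := fL (- x); rewrite symL /symmetrize => /(_ xU); lra.
Qed.

Section Transfer.
Variables (T : finType) (c : T -> G -> R).
Hypothesis dualc : is_dual_family c.

Lemma fourier_positive_type (f : G -> R) :
  (forall g, 0 <= fourier f g) -> positive_type c f.
Proof.
move=> pf t; have [/(_ t)[g gE] _ _ _] := dualc.
have := pf g; rewrite lecE Re_fourier => /andP[_].
by rewrite /cos_transform; under [X in _ -> _ <= X]eq_bigr do rewrite gE.
Qed.

Lemma symmetrize_fourier_ge0 (f : G -> R) (g : character R G) :
  positive_type c f -> 0 <= fourier (symmetrize f) g.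
Proof.
move=> pf; rewrite lecE Re_fourier Im_fourier; apply/andP; split.
  by rewrite sum_odd_symmetrize // => x; rewrite charN; case: (g x).
rewrite sum_even_symmetrize => [|x]; last by rewrite charN Re_conjc.
have [_ /(_ g)[t tE] _ _] := dualc.
by have := pf t; rewrite /cos_transform; under eq_bigr do rewrite tE.
Qed.

End Transfer.

(** Strong duality provides a pair whose ratios have product at most [1 / q], and weak duality
    bounds all such products below by [1 / q]. Agreement with the sign classes is asked only where
    [0 < f 0], which [sum_le_at0] ensures for every function that has a ratio. *)
Lemma minimum_ratios_mul (U L : {set G}) (S S' : set (G -> R)) :
  (forall x, (- x \in U) = (x \in U)) -> (forall x, (- x \in L) = (x \in L)) ->
  0 \notin U -> 0 \notin L ->
  (forall f : G -> R, 0 < f 0 -> S f <-> sign_class U L f) ->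
  (forall f : G -> R, 0 < f 0 ->
     S' f <-> sign_class (punctured_compl U) (punctured_compl L) f) ->
  minimum (ratios S) * minimum (ratios S') = 1 / q.
Proof.
move=> symU symL U0 L0 SE S'E.
have [T [c dualc]] := dual_family_exists R G.
have q0 : 0 < q by rewrite -prednKG ltr0Sn.
have symC (V : {set G}) : (forall x, (- x \in V) = (x \in V)) ->
    forall x, (- x \in punctured_compl V) = (x \in punctured_compl V).
  by move=> symV x; rewrite !in_punctured_compl symV oppr_eq0.
have [f [g [[fUL pf] [gUL pg] f1 gq gf]]] := strong_duality dualc symU symL U0 L0.
have g0 : 0 < g 0.
  by have := sum_le_at0 dualc pg; rewrite -(pmulr_rgt0 _ q0); apply: lt_le_trans; lra.
have sf : 0 < \sum_x f x by lra.
have sg : 0 < \sum_x g x by lra.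
have f0 : 0 < f 0.
  by have := sum_le_at0 dualc pf; rewrite -(pmulr_rgt0 _ q0); apply: lt_le_trans.
have fgE : f 0 / (\sum_x f x) * (g 0 / \sum_x g x) <= 1 / q.
  rewrite mulf_div ler_pdivrMr ?mulr_gt0 // mul1r ler_pdivlMl //.
  rewrite mulrC; apply: ler_pM => //; first by nra.
  by apply: le_trans gf; rewrite ler_piMl // ltW.
have weak (h k : G -> R) : sign_class U L h ->
    sign_class (punctured_compl U) (punctured_compl L) k ->
    positive_type c h -> positive_type c k ->
    0 < \sum_x h x -> 0 < \sum_x k x ->
    1 / q <= h 0 / (\sum_x h x) * (k 0 / \sum_x k x).
  move=> hUL kUL ph pk sh sk; rewrite mulf_div ler_pdivlMr ?mulr_gt0 //.
  by rewrite mul1r ler_pdivrMl //; exact: (weak_duality dualc symU symL).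
have ratio (h : G -> R) (W V : {set G}) (S1 : set (G -> R)) :
    (forall x, (- x \in W) = (x \in W)) -> (forall x, (- x \in V) = (x \in V)) ->
    (forall f : G -> R, 0 < f 0 -> S1 f <-> sign_class W V f) ->
    sign_class W V h -> positive_type c h -> 0 < h 0 -> 0 < \sum_x h x ->
    ratios S1 (h 0 / \sum_x h x).
  move=> symW symV S1E hWV ph h0 sh; apply/ratiosP; exists (symmetrize h).
  rewrite sum_symmetrize symmetrize0; split=> //; last by rewrite gt_eqF.
    by apply/S1E; rewrite ?symmetrize0 //; exact: symmetrize_sign_class.
  by move=> k; apply: (symmetrize_fourier_ge0 dualc).
have unratio (W V : {set G}) (S1 : set (G -> R)) r :
    (forall f : G -> R, 0 < f 0 -> S1 f <-> sign_class W V f) -> ratios S1 r ->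
    exists h, [/\ sign_class W V h, positive_type c h, 0 < \sum_x h x
                & r = h 0 / \sum_x h x].
  move=> S1E /ratiosP[h [S1h ph sh ->]].
  have ph' := fourier_positive_type dualc ph.
  have sh0 : 0 < \sum_x h x.
    by have := ph (principal R G); rewrite fourier_principal ler0c lt0r sh.
  exists h; split=> //; apply/S1E => //.
  by have := sum_le_at0 dualc ph'; rewrite -(pmulr_rgt0 _ q0); apply: lt_le_trans.
have fg : f 0 / (\sum_x f x) * (g 0 / \sum_x g x) = 1 / q.
  by apply/eqP; rewrite eq_le fgE weak.
(* A competitor of one optimum is paired with the other optimum, and the common positive factor
   cancels. *)
rewrite -fg; congr (_ * _); apply: minimum_eq; split.
- exact: (ratio f U L S).
- move=> r /(unratio _ _ _ _ SE)[h [hUL ph sh ->]].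
  have := weak h g hUL gUL ph pg sh sg.
  by rewrite -fg ler_pM2r // divr_gt0.
- exact: (ratio g _ _ S' (symC _ symU) (symC _ symL)).
- move=> r /(unratio _ _ _ _ S'E)[h [hUL ph sh ->]].
  have := weak f h fUL hUL pf ph sf sh.
  by rewrite -fg ler_pM2l // divr_gt0.
Qed.

(** * Packing by difference sets *)

Lemma mem_diffset0 (B : {set G}) : (0 \in diffset B) = (B != finset.set0).
Proof.
apply/imset2P/set0Pn => [[x y xB]|[x xB]]; first by exists x.
by exists x x; rewrite ?subrr.
Qed.

Lemma Deltabar_gt0 (A : {set G}) : 0 \in A -> (0 < Deltabar A)%N.
Proof.
move=> A0; apply: (@leq_trans #|[set (0 : G)]%SET|); first by rewrite cards1.
apply: (leq_bigmax_cond (P := fun B : {set G} => diffset B \subset A)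
  (F := fun B : {set G} => #|B|)).
by apply/fintype.subsetP => _ /imset2P[x y /set1P-> /set1P-> ->]; rewrite subrr.
Qed.

Lemma standard_complements_mem (A A' : {set G}) : standard_complements A A' ->
  forall x, (x \in A') = (x == 0) || (x \notin A).
Proof.
case=> _ _ /setP AU /setP AI x; move: (AU x) (AI x); rewrite !finset.inE.
by case: (x \in A); case: (x \in A'); case: (x == 0).
Qed.

(** For nonempty [B], differences meet [A] only in 0 exactly when they lie in [A']. The empty set
    satisfies only the second condition, but its size 0 does not affect the maximum. *)
Lemma Delta_Deltabar (A A' : {set G}) :
  standard_complements A A' -> Delta A = Deltabar A'.
Proof.
move=> hAA'; have compl := standard_complements_mem hAA'.
case: hAA' => [[_ A0] [_ A'0] _ _].
have condE B : (diffset B :&: A == [set 0])%SET =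
    (B != finset.set0) && (diffset B \subset A').
  rewrite -mem_diffset0; apply/eqP/andP => [BA|[B0 /fintype.subsetP BA']].
    split.
      have : 0 \in (diffset B :&: A)%SET by rewrite BA finset.inE.
      by rewrite finset.inE => /andP[].
    apply/fintype.subsetP => x xB; rewrite compl; case: eqP => //= x0.
    apply/negP => xA; apply: x0; apply/set1P; rewrite -BA finset.inE xB //.
  apply/setP => x; rewrite !finset.inE; apply/andP/eqP => [[xB xA]|-> //].
  by have := BA' x xB; rewrite compl xA orbF => /eqP.
apply/eqP; rewrite eqn_leq; apply/andP; split; apply/bigmax_leqP => B hB.
  apply: (leq_bigmax_cond (P := fun B : {set G} => diffset B \subset A')
    (F := fun B : {set G} => #|B|)).
  by move: hB; rewrite condE => /andP[].
have [->|B0] := eqVneq B finset.set0; first by rewrite cards0.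
apply: (leq_bigmax_cond
  (P := fun B : {set G} => diffset B :&: A == [set 0]%SET)
  (F := fun B : {set G} => #|B|)).
by rewrite condE B0.
Qed.

End Extremal.

(** * The four products, each computed as [1 / q] *)

Theorem theorem4p2 (R : realType) (G : finZmodType) (q : nat)
    (hq : #|G| = q) (A A' : {set G}) (hAA' : standard_complements A A') :
  [/\ delta R A * deltabar R A' = lambda R A * lambda R A',
      lambda R A * lambda R A' = lambda_minus R A * lambda_plus R A',
      lambda_minus R A * lambda_plus R A' = lambda_pm R A * lambda_pm R A'
    & lambda_pm R A * lambda_pm R A' = 1 / q%:R].
Proof.
have dd : delta R A * deltabar R A' = 1 / q%:R.
  have D0 : (Deltabar A')%:R != 0 :> R.
    by rewrite pnatr_eq0 -lt0n Deltabar_gt0 //; case: hAA' => _ [].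
  have q0 : q%:R != 0 :> R by rewrite pnatr_eq0 -hq -prednKG.
  by rewrite /delta /deltabar (Delta_Deltabar hAA') hq; field; rewrite D0 q0.
have compl := standard_complements_mem hAA'.
case: hAA' => [[symA A0] _ _ _].
have symN x : (- x \in A) = (x \in A).
  rewrite [in LHS]symA; apply/imsetP/idP => [[y yA /oppr_inj->]//|xA].
  by exists x.
(* 0 is left out of [L] since the sign at 0 is already given by [0 < f 0]. *)
pose U : {set G} := (~: A)%SET; pose L : {set G} := (A :\ 0)%SET.
have UE x : (x \in U) = (x \notin A) by rewrite finset.inE.
have LE x : (x \in L) = (x != 0) && (x \in A) by rewrite !finset.inE.
have symU x : (- x \in U) = (x \in U) by rewrite !UE symN.
have symL x : (- x \in L) = (x \in L) by rewrite !LE symN oppr_eq0.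
have U0 : 0 \notin U by rewrite UE A0.
have L0 : 0 \notin L by rewrite LE eqxx.
have U'E x : (x \in punctured_compl U) = (x \notin A').
  by rewrite in_punctured_compl UE compl negb_or.
have nz (f : G -> R) : 0 < f 0 -> nonzero_fun f.
  by move=> f0; exists 0; rewrite gt_eqF.
(* Imposing both signs on [U] makes [f] vanish off [A], and the dual function vanish off [A']. *)
have mulS : lambda R A * lambda R A' = 1 / q%:R.
  rewrite -hq; apply: (@minimum_ratios_mul _ _ U U) => // f f0; split.
  - by case=> _ fA; split=> x; rewrite UE => /fA->.
  - case=> f1 f2; split; first exact: nz.
    by move=> x xA; apply/eqP; rewrite eq_le f1 ?f2 // UE.
  - by case=> _ fA; split=> x; rewrite U'E => /fA->.
  - case=> f1 f2; split; first exact: nz.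
    by move=> x xA; apply/eqP; rewrite eq_le f1 ?f2 // U'E.
(* With an empty [L] the dual function is nonnegative at every nonzero point, so being nonpositive
   off [A'] it vanishes there. *)
have mulMP : lambda_minus R A * lambda_plus R A' = 1 / q%:R.
  rewrite -hq; apply: (@minimum_ratios_mul _ _ U finset.set0) => //.
  - by move=> x; rewrite !finset.inE.
  - by rewrite finset.inE.
  - move=> f f0; split.
      by case=> _ fA; split=> x; rewrite ?UE ?finset.inE // => /fA.
    by case=> f1 f2; split; [exact: nz | move=> x xA; apply: f1; rewrite UE].
  - move=> f f0; split.
      case=> _ fA fA'; split=> x; first by rewrite U'E => /fA->.
      by have [/fA'//|/fA->] := boolP (x \in A').
    case=> f1 f2; have f2' x : 0 <= f x.
      have [->|x0] := eqVneq x 0; first exact: ltW.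
      by apply: f2; rewrite in_punctured_compl x0 finset.inE.
    split; first exact: nz; last by [].
    by move=> x xA; apply/eqP; rewrite eq_le f2' f1 // U'E.
(* The punctured complement of [L] is [A'] without 0, so the dual class is of the same kind for
   [A']. *)
have mulpm : lambda_pm R A * lambda_pm R A' = 1 / q%:R.
  rewrite -hq; apply: (@minimum_ratios_mul _ _ U L) => //.
  - move=> f f0; split.
      case=> _ fA fA'; split=> x; first by rewrite UE => /fA.
      by rewrite LE => /andP[_ /fA'].
    case=> f1 f2; split; first exact: nz.
      by move=> x xA; apply: f1; rewrite UE.
    move=> x xA; have [->|x0] := eqVneq x 0; first exact: ltW.
    by apply: f2; rewrite LE x0.
  - have L'E x : (x \in punctured_compl L) = (x != 0) && (x \in A').
      by rewrite in_punctured_compl LE compl; case: eqP.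
    move=> f f0; split.
      case=> _ fA fA'; split=> x; first by rewrite U'E => /fA.
      by rewrite L'E => /andP[_ /fA'].
    case=> f1 f2; split; first exact: nz.
      by move=> x xA; apply: f1; rewrite U'E.
    move=> x xA; have [->|x0] := eqVneq x 0; first exact: ltW.
    by apply: f2; rewrite L'E x0.
by rewrite dd mulS mulMP mulpm.
Qed.
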